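(* Fix any data matrix $H$, and suppose $\lambda_1=0$ and that $\mathcal U\subseteq\mathbb R^m$ and $\mathcal Y\subseteq\mathbb R^p$ are convex. Then for all $\lambda_2>0$ and $\lambda_y>0$ the problems (DeePC-Hybrid) and (DeePC-SVD) given in the context have the same optimal solution $(u^*,y^*,\sigma_y^* )$; that is, a triple $(u,y,\sigma_y)$ is the $(u,y,\sigma_y)$-part of an optimal solution $(g,u,y,\sigma_y)$ of (DeePC-Hybrid) if and only if it is the $(u,y,\sigma_y)$-part of an optimal solution $(\bar g,u,y,\sigma_y)$ of (DeePC-SVD).
   Context: Notation: $\mathrm{col}(A_1,\dots,A_k)=[A_1^{\mathsf T},\dots,A_k^{\mathsf T}]^{\mathsf T}$; $A^\dagger$ is the Moore–Penrose pseudoinverse. Data. Let $m,p,T_{\rm ini},N,T$ be positive integers, $L=T_{\rm ini}+N\le T$. Let $u_{\rm d}=\mathrm{col}(u_{\rm d}(1),\dots,u_{\rm d}(T))$ with $u_{\rm d}(i)\in\mathbb R^m$ and $y_{\rm d}=\mathrm{col}(y_{\rm d}(1),\dots,y_{\rm d}(T))$ with $y_{\rm d}(i)\in\mathbb R^p$ be the pre-collected (possibly noisy) input/output data. For a sequence $\omega$ of length $T$, $\mathcal H_L(\omega)$ is the Hankel matrix with $L$ block rows and $T-L+1$ columns whose $(i,j)$ block is $\omega(i+j-1)$. Partition $\mathcal H_L(u_{\rm d})=\mathrm{col}(U_{\rm P},U_{\rm F})$ and $\mathcal H_L(y_{\rm d})=\mathrm{col}(Y_{\rm P},Y_{\rm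 F})$, where the subscript P denotes the first $T_{\rm ini}$ block rows and F the last $N$ block rows. The data matrix is $H=\mathrm{col}(U_{\rm P},Y_{\rm P},U_{\rm F},Y_{\rm F})$. Put $H_1=\mathrm{col}(U_{\rm P},Y_{\rm P},U_{\rm F})$ and $\Pi_1=H_1^\dagger H_1$. Let $H=W\Sigma V^{\mathsf T}$ be a compact singular value decomposition ($r=\mathrm{rank}\,H$, $\Sigma\in\mathbb R^{r\times r}$ diagonal containing the nonzero singular values, $W^{\mathsf T}W=I$, $V^{\mathsf T}V=I$). Let $\bar H=W\Sigma$, partitioned by rows conformably with $H$ as $\bar H=\mathrm{col}(\bar U_{\rm P},\bar Y_{\rm P},\bar U_{\rm F},\bar Y_{\rm F})$, and put $\bar H_1=\mathrm{col}(\bar U_{\rm P},\bar Y_{\rm P},\bar U_{\rm F})$, $\bar\Pi_1=\bar H_1^\dagger\bar H_1$. Let $u_{\rm ini}\in\mathbb R^{mT_{\rm ini}}$, $y_{\rm ini}\in\mathbb R^{pT_{\rm ini}}$ be given. The decision variables are $g\in\mathbb R^{T-L+1}$ (respectively $\bar g\in\mathbb R^{r}$), $\sigma_y\in\mathbb R^{pT_{\rm ini}}$, $u=\mathrm{col}(u(t),\dots,u(t+N-1))\in\mathbb R^{mN}$, $y=\mathrm{col}(y(t),\dots,y(t+N-1))\in\mathbb R^{pN}$. The weights $R\in\mathbb S^m_+$ and $Q\in\mathbb S^p_+$ are symmetric positive semidefinite, $\|u\|_R^2=\sum_{k=t}^{t+N-1}u(k)^{\mathsf T}Ru(k)$ and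 $\|y\|_Q^2=\sum_{k=t}^{t+N-1}y(k)^{\mathsf T}Qy(k)$. The constraints ''$u\in\mathcal U$, $y\in\mathcal Y$'' mean $u(k)\in\mathcal U$ and $y(k)\in\mathcal Y$ for all $k\in\{t,\dots,t+N-1\}$. (DeePC-Hybrid): minimize over $(g,\sigma_y,u,y)$ with $u\in\mathcal U$, $y\in\mathcal Y$ the cost $\|u\|_R^2+\|y\|_Q^2+\lambda_1\|g\|_1+\lambda_2\|(I-\Pi_1)g\|_2^2+\lambda_y\|\sigma_y\|_2^2$ subject to $H g=\mathrm{col}(u_{\rm ini},\,y_{\rm ini}+\sigma_y,\,u,\,y)$. (DeePC-SVD): minimize over $(\bar g,\sigma_y,u,y)$ with $u\in\mathcal U$, $y\in\mathcal Y$ the cost $\|u\|_R^2+\|y\|_Q^2+\lambda_1\|\bar g\|_1+\lambda_2\|(I-\bar\Pi_1)\bar g\|_2^2+\lambda_y\|\sigma_y\|_2^2$ subject to $\bar H\bar g=\mathrm{col}(u_{\rm ini},\,y_{\rm ini}+\sigma_y,\,u,\,y)$. *)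

(* Defs.v *)
(* MathComp / MathComp-Analysis development over an arbitrary R : realType. *)
From HB Require Import structures.
From mathcomp Require Import all_boot all_order all_algebra.
From mathcomp Require Import classical_sets reals convex.

Set Implicit Arguments.
Unset Strict Implicit.
Unset Printing Implicit Defensive.

Import Order.TTheory GRing.Theory Num.Theory.
Local Open Scope ring_scope.

(* Size of a stack of k blocks with q rows each, in the form k * q takes in
   the block-matrix theory of matrix.v; an element of 'cV[R]_(stack k q) is
   col(v_0, ..., v_(k-1)) with v_i : 'cV[R]_q. *)
Definition stack (k q : nat) : nat := (\sum_(i < k) q)%N.

Section MoorePenrose.
Variable R : realType.

(* The four Penrose equations: "X is a Moore-Penrose pseudoinverse of A". *)
Definition penrose m n (A : 'M[R]_(m, n)) (X : 'M[R]_(n, m)) : bool :=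
  [&& A *m X *m A == A, X *m A *m X == X,
      (A *m X)^T == A *m X & (X *m A)^T == X *m A].

Lemma penrose_uniq m n (A : 'M[R]_(m, n)) (X Y : 'M[R]_(n, m)) :
  penrose A X -> penrose A Y -> X = Y.
Proof.
case/and4P=> /eqP X1 /eqP X2 /eqP X3 /eqP X4.
case/and4P=> /eqP Y1 /eqP Y2 /eqP Y3 /eqP Y4.
have AXY : A *m X = A *m Y.
  by rewrite -X3 -[in LHS]Y1 -mulmxA trmx_mul X3 Y3 mulmxA X1.
have XAY : X *m A = Y *m A.
  by rewrite -X4 -[in LHS]Y1 -!mulmxA mulmxA trmx_mul X4 Y4 -!mulmxA
             (mulmxA A) X1.
by rewrite -X2 -mulmxA AXY mulmxA XAY Y2.
Qed.

Lemma gram_unit m n (F : 'M[R]_(m, n)) : row_free F -> F *m F^T \in unitmx.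
Proof.
move=> fF; rewrite -row_free_unit -kermx_eq0; apply/rowV0P => v /sub_kermxP.
move=> /(congr1 (mulmx^~ v^T)); rewrite mul0mx mulmxA -mulmxA -trmx_mul.
move=> vFFv; have vF0 : v *m F = 0.
  have /eqP : \sum_j (v *m F) 0 j ^+ 2 = 0.
    transitivity ((v *m F *m (v *m F)^T) 0 0).
      by rewrite [RHS]mxE; apply: eq_bigr => j _; rewrite expr2 [_^T _ _]mxE.
    by rewrite vFFv mxE.
  rewrite psumr_eq0 => [/allP h|j _]; last exact: sqr_ge0.
  apply/rowP => j; have := h j (mem_index_enum _).
  by rewrite sqrf_eq0 => /eqP ->; rewrite mxE.
by apply: (row_free_inj fF); rewrite mul0mx.
Qed.

Lemma penrose_full_rank m n r (C : 'M[R]_(m, r)) (F : 'M[R]_(r, n)) :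
  row_free F -> row_full C ->
  penrose (C *m F) (F^T *m invmx (F *m F^T) *m invmx (C^T *m C) *m C^T).
Proof.
move=> fF fC; have uF := gram_unit fF.
have uC : C^T *m C \in unitmx.
  rewrite -[X in _ *m X]trmxK; apply/gram_unit.
  by rewrite /row_free mxrank_tr -/(row_full C).
set G := invmx (F *m F^T); set K := invmx (C^T *m C).
have GT : G^T = G by rewrite /G trmx_inv trmx_mul trmxK.
have KT : K^T = K by rewrite /K trmx_inv trmx_mul trmxK.
have FG : F *m (F^T *m G) = 1%:M by rewrite mulmxA mulmxV.
have KC : K *m C^T *m C = 1%:M by rewrite -mulmxA mulVmx.
have AX : C *m F *m (F^T *m G *m K *m C^T) = C *m (K *m C^T).
  by rewrite -(mulmxA _ K) -(mulmxA C) (mulmxA F) FG mul1mx.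
have XA : F^T *m G *m K *m C^T *m (C *m F) = F^T *m G *m F.
  by rewrite mulmxA -(mulmxA _ K) -(mulmxA _ _ C) KC mulmx1.
apply/and4P; split; apply/eqP.
- by rewrite AX !mulmxA -2!(mulmxA C) KC mulmx1.
- by rewrite XA -(mulmxA _ K) (mulmxA (F^T *m G *m F)) -(mulmxA _ F)
             FG mulmx1.
- by rewrite AX !trmx_mul trmxK KT mulmxA.
- by rewrite XA !trmx_mul trmxK GT mulmxA.
Qed.

Lemma penrose_exists m n (A : 'M[R]_(m, n)) : exists X, penrose A X.
Proof.
rewrite -(mulmx_base A); eexists; apply: penrose_full_rank.
  exact: row_base_free.
exact: col_base_full.
Qed.

Definition pinv m n (A : 'M[R]_(m, n)) : 'M[R]_(n, m) :=
  xchoose (penrose_exists A).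

Lemma pinvP m n (A : 'M[R]_(m, n)) : penrose A (pinv A).
Proof. exact: xchooseP. Qed.

End MoorePenrose.

Section Deepc.
Variable R : realType.

Definition psd q (M : 'M[R]_q) : Prop :=
  M^T = M /\ forall x : 'cV[R]_q, 0 <= (x^T *m M *m x) 0 0.

(* The ordering of the singular values is left free. *)
Definition compact_svd a b r (H : 'M[R]_(a, b))
    (W : 'M[R]_(a, r)) (S : 'M[R]_r) (V : 'M[R]_(b, r)) : Prop :=
  [/\ r = \rank H, H = W *m S *m V^T,
      is_diag_mx S /\ (forall i, 0 < S i i),
      W^T *m W = 1%:M & V^T *m V = 1%:M].

Definition block k q n (A : 'M[R]_(stack k q, n)) (i : 'I_k) : 'M[R]_(q, n) :=
  submxcol (p_ := fun=> q) A i.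

Lemma hankel_idx_proof L T (LT : (L <= T)%N) (i : 'I_L) (j : 'I_(T - L).+1) :
  (i + j < T)%N.
Proof.
rewrite -[X in (_ < X)%N](subnKC LT) -addSn.
by apply: leq_add; [exact: ltn_ord | rewrite -ltnS; exact: ltn_ord].
Qed.

Definition hankel_idx L T (LT : (L <= T)%N) (i : 'I_L) (j : 'I_(T - L).+1) :
  'I_T := Ordinal (hankel_idx_proof LT i j).

(* With 0-based indices, block (i, j) is the sample w(i + j). *)
Definition hankel q L T (LT : (L <= T)%N) (w : 'cV[R]_(stack T q)) :
  'M[R]_(stack L q, (T - L).+1) :=
  \mxcol_(i < L) \matrix_(a < q, j < (T - L).+1)
    block w (hankel_idx LT i j) a 0.

Definition past q Tini N n (A : 'M[R]_(stack (Tini + N) q, n)) :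
  'M[R]_(stack Tini q, n) := \mxcol_(i < Tini) block A (lshift N i).

Definition future q Tini N n (A : 'M[R]_(stack (Tini + N) q, n)) :
  'M[R]_(stack N q, n) := \mxcol_(i < N) block A (rshift Tini i).

(* Drops the last of the four row blocks: col(A, B, C, D) |-> col(A, B, C). *)
Definition drop_last_block a b c d n (A : 'M[R]_(a + (b + (c + d)), n)) :
  'M[R]_(a + (b + c), n) :=
  col_mx (usubmx A)
    (col_mx (usubmx (dsubmx A)) (usubmx (dsubmx (dsubmx A)))).

Section Data.
Variables (m p Tini N T : nat) (LT : (Tini + N <= T)%N).
Variables (ud : 'cV[R]_(stack T m)) (yd : 'cV[R]_(stack T p)).

Definition data_mx :
  'M[R]_(stack Tini m + (stack Tini p + (stack N m + stack N p)),
         (T - (Tini + N)).+1) :=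
  col_mx (past (hankel LT ud))
    (col_mx (past (hankel LT yd))
      (col_mx (future (hankel LT ud)) (future (hankel LT yd)))).

Definition data_mx1 :
  'M[R]_(stack Tini m + (stack Tini p + stack N m), (T - (Tini + N)).+1) :=
  col_mx (past (hankel LT ud))
    (col_mx (past (hankel LT yd)) (future (hankel LT ud))).

Lemma drop_last_block_data_mx : drop_last_block data_mx = data_mx1.
Proof. by rewrite /drop_last_block /data_mx !(col_mxKu, col_mxKd). Qed.

End Data.

Definition norm1 n (v : 'cV[R]_n) : R := \sum_i `|v i 0|.
Definition sqnorm2 n (v : 'cV[R]_n) : R := \sum_i v i 0 ^+ 2.
Definition sqnormW k q (M : 'M[R]_q) (v : 'cV[R]_(stack k q)) : R :=
  \sum_(i < k) ((block v i)^T *m M *m block v i) 0 0.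

(* Both problems have the same shape: they differ only in the data matrix H
   (with n columns) and in the matrix H1 that defines the projection. *)
Section Problem.
Variables (m p Tini N n : nat).
Variable H : 'M[R]_(stack Tini m + (stack Tini p + (stack N m + stack N p)), n).
Variable H1 : 'M[R]_(stack Tini m + (stack Tini p + stack N m), n).
Variables (uini : 'cV[R]_(stack Tini m)) (yini : 'cV[R]_(stack Tini p)).
Variables (Uset : set 'cV[R]_m) (Yset : set 'cV[R]_p).
Variables (Rw : 'M[R]_m) (Qw : 'M[R]_p) (lambda1 lambda2 lambday : R).

Definition deepc_feasible (g : 'cV[R]_n) (sy : 'cV[R]_(stack Tini p))
    (u : 'cV[R]_(stack N m)) (y : 'cV[R]_(stack N p)) : Prop :=
  [/\ forall k, Uset (block u k),
      forall k, Yset (block y k) &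
      H *m g = col_mx uini (col_mx (yini + sy) (col_mx u y))].

Definition deepc_cost (g : 'cV[R]_n) (sy : 'cV[R]_(stack Tini p))
    (u : 'cV[R]_(stack N m)) (y : 'cV[R]_(stack N p)) : R :=
  sqnormW Rw u + sqnormW Qw y + lambda1 * norm1 g
  + lambda2 * sqnorm2 ((1%:M - pinv H1 *m H1) *m g) + lambday * sqnorm2 sy.

Definition deepc_optimal (g : 'cV[R]_n) (sy : 'cV[R]_(stack Tini p))
    (u : 'cV[R]_(stack N m)) (y : 'cV[R]_(stack N p)) : Prop :=
  deepc_feasible g sy u y /\
  forall g' sy' u' y', deepc_feasible g' sy' u' y' ->
    deepc_cost g sy u y <= deepc_cost g' sy' u' y'.

End Problem.

End Deepc.

(* Main.v *)
(* Since H = (W S) V^T with V^T V = 1, the projections satisfy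
   Pi1 = V Pibar1 V^T.  Hence gbar |-> V gbar sends feasible points of the
   reduced problem to feasible points of the original one at equal cost, while
   g |-> V^T g goes the other way without increasing the cost, because V^T is
   a contraction. *)
Require Import Defs.
From HB Require Import structures.
From mathcomp Require Import all_boot all_order all_algebra.
From mathcomp Require Import classical_sets reals convex.

Set Implicit Arguments.
Unset Strict Implicit.
Unset Printing Implicit Defensive.

Import Order.TTheory GRing.Theory Num.Theory.
Local Open Scope ring_scope.

Section Isometry.
Variable R : realType.

Lemma sqnorm2E n (v : 'cV[R]_n) : sqnorm2 v = (v^T *m v) 0 0.
Proof. by rewrite mxE; apply: eq_bigr => i _; rewrite mxE expr2. Qed.

Lemma sqnorm2_ge0 n (v : 'cV[R]_n) : 0 <= sqnorm2 v.
Proof. by apply: sumr_ge0 => i _; exact: sqr_ge0. Qed.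

Variables (n r : nat) (V : 'M[R]_(n, r)).
Hypothesis VV : V^T *m V = 1%:M.

Lemma sqnorm2_isometry (z : 'cV[R]_r) : sqnorm2 (V *m z) = sqnorm2 z.
Proof. by rewrite !sqnorm2E trmx_mul -mulmxA (mulmxA V^T) VV mul1mx. Qed.

(** Pythagoras: [V *m V^T] is an orthogonal projection, so the gap between the two sides is the
    squared norm of the component of [z] it removes. *)
Lemma sqnorm2_trmx_isometry_le (z : 'cV[R]_n) :
  sqnorm2 (V^T *m z) <= sqnorm2 z.
Proof.
rewrite -subr_ge0.
suff -> : sqnorm2 z - sqnorm2 (V^T *m z) = sqnorm2 (z - V *m (V^T *m z)).
  exact: sqnorm2_ge0.
(* This orthogonality kills the cross term when the squared norm of the removed component is
   expanded. *)
have orth : V^T *m (z - V *m (V^T *m z)) = 0.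
  by rewrite mulmxBr (mulmxA V^T V) VV mul1mx subrr.
rewrite !sqnorm2E [(z - _)^T]raddfB /= mulmxBl (trmx_mul V) -(mulmxA _ V^T) orth.
by rewrite mulmx0 subr0 mulmxBr !trmx_mul trmxK !mulmxA !mxE.
Qed.

(** By uniqueness it suffices to check the Penrose equations for [V *m pinv A]; each reduces to one
    for [A] by cancelling [V^T *m V]. *)
Lemma pinv_mul_isometry m (A : 'M[R]_(m, r)) :
  pinv (A *m V^T) = V *m pinv A.
Proof.
apply: penrose_uniq (pinvP _) _.
have /and4P[/eqP A1 /eqP A2 /eqP A3 /eqP A4] := pinvP A.
have AX : A *m V^T *m (V *m pinv A) = A *m pinv A.
  by rewrite -mulmxA (mulmxA V^T) VV mul1mx.
apply/and4P; split; apply/eqP.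
- by rewrite AX mulmxA A1.
- by rewrite -mulmxA AX -mulmxA (mulmxA (pinv A)) A2.
- by rewrite AX A3.
- have -> : V *m pinv A *m (A *m V^T) = V *m (pinv A *m A) *m V^T.
    by rewrite !mulmxA.
  by rewrite trmx_mul trmxK trmx_mul A4 !mulmxA.
Qed.

Lemma proj_mul_isometry m (A : 'M[R]_(m, r)) :
  pinv (A *m V^T) *m (A *m V^T) = V *m (pinv A *m A) *m V^T.
Proof. by rewrite pinv_mul_isometry !mulmxA. Qed.

Lemma residual_isometry m (A : 'M[R]_(m, r)) (z : 'cV[R]_r) :
  (1%:M - pinv (A *m V^T) *m (A *m V^T)) *m (V *m z)
  = V *m ((1%:M - pinv A *m A) *m z).
Proof.
rewrite proj_mul_isometry !mulmxBl !mul1mx mulmxBr; congr (_ - _).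
by rewrite -(mulmxA _ V^T) (mulmxA V^T) VV mul1mx -mulmxA.
Qed.

(** [V^T] intertwines the two residual projections, so the contraction bound applies to the
    regularizer. *)
Lemma residual_trmx_isometry m (A : 'M[R]_(m, r)) (z : 'cV[R]_n) :
  (1%:M - pinv A *m A) *m (V^T *m z)
  = V^T *m ((1%:M - pinv (A *m V^T) *m (A *m V^T)) *m z).
Proof.
rewrite proj_mul_isometry !mulmxBl !mul1mx mulmxBr; congr (_ - _).
by rewrite !mulmxA VV mul1mx.
Qed.

End Isometry.

(** Carries the factorization of the data matrix over to its first three row blocks. *)
Lemma drop_last_block_mulmx (R : realType) a b c d n k
    (A : 'M[R]_(a + (b + (c + d)), n)) (B : 'M[R]_(n, k)) :
  drop_last_block (A *m B) = drop_last_block A *m B.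
Proof. by rewrite /drop_last_block -!mul_dsub_mx -!mul_usub_mx !mul_col_mx. Qed.

Theorem theorem2 (R : realType) (m p Tini N T r : nat)
    (m_gt0 : (0 < m)%N) (p_gt0 : (0 < p)%N) (Tini_gt0 : (0 < Tini)%N)
    (N_gt0 : (0 < N)%N) (T_gt0 : (0 < T)%N) (LT : (Tini + N <= T)%N)
    (ud : 'cV[R]_(stack T m)) (yd : 'cV[R]_(stack T p))
    (W : 'M[R]_(stack Tini m + (stack Tini p + (stack N m + stack N p)), r))
    (S : 'M[R]_r) (V : 'M[R]_((T - (Tini + N)).+1, r))
    (svdH : compact_svd (data_mx LT ud yd) W S V)
    (uini : 'cV[R]_(stack Tini m)) (yini : 'cV[R]_(stack Tini p))
    (Uset : set 'cV[R]_m) (Yset : set 'cV[R]_p)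
    (Rw : 'M[R]_m) (Qw : 'M[R]_p) (lambda1 lambda2 lambday : R)
    (psdR : psd Rw) (psdQ : psd Qw)
    (lambda1_eq0 : lambda1 = 0)
    (convexU : convex_set Uset) (convexY : convex_set Yset)
    (lambda2_gt0 : 0 < lambda2) (lambday_gt0 : 0 < lambday)
    (u : 'cV[R]_(stack N m)) (y : 'cV[R]_(stack N p))
    (sy : 'cV[R]_(stack Tini p)) :
  (exists g : 'cV[R]_((T - (Tini + N)).+1),
     deepc_optimal (data_mx LT ud yd) (data_mx1 LT ud yd)
       uini yini Uset Yset Rw Qw lambda1 lambda2 lambday g sy u y)
  <->
  (exists gbar : 'cV[R]_r,
     deepc_optimal (W *m S) (drop_last_block (W *m S))
       uini yini Uset Yset Rw Qw lambda1 lambda2 lambday gbar sy u y).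
Proof.
case: svdH => _ HE _ _ VV; rewrite -drop_last_block_data_mx HE.
rewrite drop_last_block_mulmx; move: (W *m S) => B; rewrite lambda1_eq0.
set H1 := drop_last_block B.
have feasVt g s v w : deepc_feasible (B *m V^T) uini yini Uset Yset g s v w ->
    deepc_feasible B uini yini Uset Yset (V^T *m g) s v w.
  by case=> Hu Hy Hg; split=> //; rewrite mulmxA.
have feasV g s v w : deepc_feasible B uini yini Uset Yset g s v w ->
    deepc_feasible (B *m V^T) uini yini Uset Yset (V *m g) s v w.
  by case=> Hu Hy Hg; split=> //; rewrite -mulmxA (mulmxA V^T) VV mul1mx.
(* With the 1-norm weight zero, only the projection term depends on [g]. *)
have costVt g s v w :
    deepc_cost H1 Rw Qw 0 lambda2 lambday (V^T *m g) s v w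
    <= deepc_cost (H1 *m V^T) Rw Qw 0 lambda2 lambday g s v w.
  rewrite /deepc_cost !mul0r lerD2r lerD2l ler_pM2l //.
  by rewrite residual_trmx_isometry // sqnorm2_trmx_isometry_le.
have costV g s v w :
    deepc_cost (H1 *m V^T) Rw Qw 0 lambda2 lambday (V *m g) s v w
    = deepc_cost H1 Rw Qw 0 lambda2 lambday g s v w.
  by rewrite /deepc_cost !mul0r residual_isometry // sqnorm2_isometry.
split=> -[g [feas opt]].
(* The competitor [g'] is lifted to [V *m g'] at equal cost, where optimality of [g] applies. *)
- exists (V^T *m g); split=> [|g' s' u' y' feas']; first exact: feasVt.
  by apply: le_trans (costVt _ _ _ _) _; rewrite -costV; apply/opt/feasV.
(* Here the competitor is compressed to [V^T *m g'], which costs no more than [g']. *)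
- exists (V *m g); split=> [|g' s' u' y' feas']; first exact: feasV.
  by rewrite costV; apply: le_trans (costVt _ _ _ _); apply/opt/feasVt.
Qed.
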